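(* Let $m\geq 3$, $n\geq 3$ and $x$ be positive integers such that both $m$ and $n$ divide $3x$, and let $h,u$ be positive integers. Suppose the following conditions are satisfied: (i) there exists a $3$-RGDD$(h^u)$; (ii) there exists an $(m,n)\text{-}\mathrm{HWP}(3x;r_\beta,s_\beta)$; (iii) there exists a decomposition of $K_{(x:h)}$ into $r_\gamma$ $C_m$-factors and $s_\gamma$ $C_n$-factors; (iv) for each $p\in\{1,2,\ldots,\frac{h(u-1)}{2}\}$, there exists a decomposition of $K_{(x:3)}$ into $r_p$ $C_m$-factors and $s_p$ $C_n$-factors. Let $$r_\alpha=\sum_{p=1}^{\frac{h(u-1)}{2}-1} r_p\quad\text{and}\quad s_\alpha=\sum_{p=1}^{\frac{h(u-1)}{2}-1} s_p.$$ Then there exists an $(m,n)\text{-}\mathrm{HWP}(hux;r_\alpha+r_\beta+r_\gamma,s_\alpha+s_\beta+s_\gamma)$.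
   Context: A $C_m$-factor of a graph $G$ is a spanning subgraph of $G$ all of whose connected components are cycles of length $m$. A decomposition of a graph is a partition of its edge set into (edge sets of) subgraphs. For integers $m,n\ge 3$, $v\geq 1$ and $r,s\geq 0$, an $(m,n)\text{-}\mathrm{HWP}(v;r,s)$ is a decomposition of the complete graph $K_v$ if $v$ is odd, or of $K_v-F$ for some $1$-factor (perfect matching) $F$ of $K_v$ if $v$ is even, into $r$ $C_m$-factors and $s$ $C_n$-factors. $K_{(h:u)}$ denotes the complete multipartite graph with $u$ parts of size $h$. A $3$-RGDD$(h^u)$ (resolvable group divisible design with block size $3$ and index $1$) is a triple $(\mathcal{V},\mathcal{G},\mathcal{B})$ where $\mathcal{V}$ is a set of size $hu$, $\mathcal{G}$ is a partition of $\mathcal{V}$ into $u>1$ subsets (called groups) of size $h$, and $\mathcal{B}$ is a collection of $3$-element subsets of $\mathcal{V}$ (called blocks) such that no two distinct elements of the same group lie together in a block, any two elements from different groups lie together in exactly one block, and $\mathcal{B}$ can be partitioned into parallel classes, each element of $\mathcal{V}$ lying in exactly one block of each parallel class. (Such a design has $\frac{h(u-1)}{2}$ parallel classes.) *)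

(* Defs.v *)
From mathcomp Require Import all_boot.

Set Implicit Arguments.
Unset Strict Implicit.
Unset Printing Implicit Defensive.

Record sgraph (T : finType) := SGraph {
  adj :> rel T;
  adj_sym : symmetric adj;
  adj_irrefl : irreflexive adj
}.

Definition subgraph (T : finType) (H G : sgraph T) : Prop :=
  forall x y, H x y -> G x y.

Definition component (T : finType) (H : sgraph T) (x : T) : {set T} :=
  [set y | connect H x y].

(* The subgraph of H induced on C is the cycle running through c in order;
   meaningful for m >= 3 only. *)
Definition is_cycle (T : finType) (m : nat) (H : sgraph T) (C : {set T}) :
    Prop :=
  exists c : seq T,
    [/\ uniq c, size c = m, C = [set:: c] &
        {in C &, forall x y, H x y = (y == next c x) || (x == next c y)}].

(* Spanning is built in: H and G share the vertex type T. *)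
Definition cycle_factor (T : finType) (m : nat) (G H : sgraph T) : Prop :=
  subgraph H G /\ forall x, is_cycle m H (component H x).

Definition decomposition (T I : finType) (G : sgraph T) (H : I -> sgraph T) :
    Prop :=
  (forall i, subgraph (H i) G) /\
  (forall x y, G x y -> exists! i, H i x y).

(* The subgraphs are indexed by a disjoint sum, so that r and s count them
   separately even when m = n. On a nonempty vertex set a cycle factor has an
   edge, hence distinct indices give distinct, nonempty blocks of edges. *)
Definition cycle_decomposable (T : finType) (G : sgraph T) (m n r s : nat) :
    Prop :=
  exists H : 'I_r + 'I_s -> sgraph T,
    [/\ decomposition G H,
        forall i : 'I_r, cycle_factor m G (H (inl i)) &
        forall j : 'I_s, cycle_factor n G (H (inr j))].

Section Graphs.

Variable T : finType.

Definition complete_rel : rel T := [rel x y | x != y].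

Lemma complete_sym : symmetric complete_rel.
Proof. by move=> x y; rewrite /complete_rel /= eq_sym. Qed.

Lemma complete_irrefl : irreflexive complete_rel.
Proof. by move=> x; rewrite /complete_rel /= eqxx. Qed.

Definition complete : sgraph T := SGraph complete_sym complete_irrefl.

Variables G F : sgraph T.

Definition gminus_rel : rel T := [rel x y | G x y && ~~ F x y].

Lemma gminus_sym : symmetric gminus_rel.
Proof. by move=> x y; rewrite /gminus_rel /= (adj_sym G) (adj_sym F). Qed.

Lemma gminus_irrefl : irreflexive gminus_rel.
Proof. by move=> x; rewrite /gminus_rel /= adj_irrefl. Qed.

Definition gminus : sgraph T := SGraph gminus_sym gminus_irrefl.

Definition one_factor : Prop :=
  subgraph F G /\ forall x, #|[set y | F x y]| = 1.

End Graphs.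

Section Multipartite.

Variables h u : nat.

(* Vertex (i, a) is the a-th point of the i-th part. *)
Definition multipartite_rel : rel ('I_u * 'I_h)%type :=
  [rel x y | x.1 != y.1].

Lemma multipartite_sym : symmetric multipartite_rel.
Proof. by move=> x y; rewrite /multipartite_rel /= eq_sym. Qed.

Lemma multipartite_irrefl : irreflexive multipartite_rel.
Proof. by move=> x; rewrite /multipartite_rel /= eqxx. Qed.

(* K_(h:u): u parts of size h, in this order of the arguments. *)
Definition multipartite : sgraph ('I_u * 'I_h)%type :=
  SGraph multipartite_sym multipartite_irrefl.

End Multipartite.

Definition HWP (m n v r s : nat) : Prop :=
  if odd v then cycle_decomposable (complete 'I_v) m n r s
  else exists F : sgraph 'I_v,
    one_factor (complete 'I_v) F /\
    cycle_decomposable (gminus (complete 'I_v) F) m n r s.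

(* A repeated block would cover a pair twice, so a set of blocks suffices. *)
Record is_RGDD3 (h u : nat) (V : finType) (Gr B : {set {set V}}) : Prop := {
  rgdd_points : #|V| = h * u;
  rgdd_groups : partition Gr [set: V];
  rgdd_gt1 : 1 < u;
  rgdd_ngroups : #|Gr| = u;
  rgdd_group_size : forall A, A \in Gr -> #|A| = h;
  rgdd_block_size : forall b, b \in B -> #|b| = 3;
  rgdd_same_group : forall A x y b, A \in Gr -> x \in A -> y \in A -> x != y ->
    b \in B -> ~~ ((x \in b) && (y \in b));
  rgdd_diff_groups : forall A A' x y, A \in Gr -> A' \in Gr -> A != A' ->
    x \in A -> y \in A' -> #|[set b in B | (x \in b) && (y \in b)]| = 1;
  rgdd_resolvable : exists P : {set {set {set V}}},
    partition P B /\ forall Q, Q \in P -> partition Q [set: V]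
}.

Definition RGDD3 (h u : nat) : Prop :=
  exists (V : finType) (Gr B : {set {set V}}), is_RGDD3 h u Gr B.

(* Main.v *)
(* Give every point of the RGDD weight x, that is, replace the point set V by
   V * 'I_x. One parallel class carries a copy of the HWP(3x) on each inflated
   block, which also covers the edges between points of the same fibre; the
   other classes carry the decompositions of K_(x:3), one class per index p;
   the inflated groups carry the decomposition of K_(x:h). Each kind of piece
   is a vertex-disjoint union of copies of one graph, and factors of the copies
   with the same index unite to a factor of the whole vertex set. *)

Require Import Defs.
From mathcomp Require Import all_boot zify.

Set Implicit Arguments.
Unset Strict Implicit.
Unset Printing Implicit Defensive.

(** * Edge-disjoint unions of decomposable graphs *)

Lemma eq_cycle_decomposable (T : finType) (G G' : sgraph T) (m n r s : nat) :
  G =2 G' -> cycle_decomposable G m n r s -> cycle_decomposable G' m n r s.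
Proof.
move=> eqG [H [[subH exH] Hm Hn]]; exists H; split.
- split=> [i x y /subH|x y]; first by rewrite eqG.
  by rewrite -eqG; exact: exH.
- by move=> i; have [? ?] := Hm i; split=> // x y /subH; rewrite eqG.
- by move=> i; have [? ?] := Hn i; split=> // x y /subH; rewrite eqG.
Qed.

(** The two families are concatenated, [split] telling from which of them an index comes.
    Disjointness of [G1] and [G2] keeps an edge from being covered once by each family. *)
Lemma cycle_decomposable_union (T : finType) (G G1 G2 : sgraph T)
    (m n r1 s1 r2 s2 : nat) :
    (forall x y, G x y = G1 x y || G2 x y) ->
    (forall x y, G1 x y -> ~~ G2 x y) ->
    cycle_decomposable G1 m n r1 s1 -> cycle_decomposable G2 m n r2 s2 ->
  cycle_decomposable G m n (r1 + r2) (s1 + s2).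
Proof.
move=> GE G12 [H1 [D1 M1 N1]] [H2 [D2 M2 N2]].
pose H (k : 'I_(r1 + r2) + 'I_(s1 + s2)) := match k with
  | inl i => match split i with inl a => H1 (inl a) | inr b => H2 (inl b) end
  | inr j => match split j with inl a => H1 (inr a) | inr b => H2 (inr b) end
  end.
(* The two index types embed through [e1] and [e2], which by [eP] jointly reach every index;
   inclusion and uniqueness are then checked on each image. *)
pose e1 (k : 'I_r1 + 'I_s1) : 'I_(r1 + r2) + 'I_(s1 + s2) :=
  match k with inl i => inl (lshift r2 i) | inr j => inr (lshift s2 j) end.
pose e2 (k : 'I_r2 + 'I_s2) : 'I_(r1 + r2) + 'I_(s1 + s2) :=
  match k with inl i => inl (rshift r1 i) | inr j => inr (rshift s1 j) end.
have He1 k : H (e1 k) = H1 k.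
  by case: k => i; rewrite /H /e1 -[lshift _ _]/(unsplit (inl i)) unsplitK.
have He2 k : H (e2 k) = H2 k.
  by case: k => i; rewrite /H /e2 -[rshift _ _]/(unsplit (inr i)) unsplitK.
have eP k : (exists i, k = e1 i) \/ (exists i, k = e2 i).
  case: k => i; rewrite -(splitK i); case: (split i) => j /=.
  - by left; exists (inl j).
  - by right; exists (inl j).
  - by left; exists (inr j).
  - by right; exists (inr j).
have subH k : subgraph (H k) G.
  move=> x y; rewrite GE; case: (eP k) => [[i ->]|[i ->]].
    by rewrite He1 => /(proj1 D1 i) ->.
  by rewrite He2 => /(proj1 D2 i) ->; rewrite orbT.
exists H; split.
- split=> // x y; rewrite GE => /orP[G1xy|G2xy].
    have [i [Hi Ui]] := proj2 D1 _ _ G1xy.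
    exists (e1 i); split; first by rewrite He1.
    move=> k; case: (eP k) => [[j ->]|[j ->]]; first by rewrite He1 => /Ui ->.
    by rewrite He2 => /(proj1 D2 j); rewrite (negPf (G12 _ _ G1xy)).
  have [i [Hi Ui]] := proj2 D2 _ _ G2xy.
  exists (e2 i); split; first by rewrite He2.
  move=> k; case: (eP k) => [[j ->]|[j ->]]; last by rewrite He2 => /Ui ->.
  by rewrite He1 => /(proj1 D1 j) /G12; rewrite G2xy.
- move=> i; split=> //; rewrite /H.
  by case: (split i) => j; [case: (M1 j) | case: (M2 j)].
- move=> i; split=> //; rewrite /H.
  by case: (split i) => j; [case: (N1 j) | case: (N2 j)].
Qed.

Lemma cycle_decomposable_empty (T : finType) (G : sgraph T) (m n : nat) :
  (forall x y, ~~ G x y) -> cycle_decomposable G m n 0 0.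
Proof.
move=> G0; exists (fun=> G); split; [split | by case | by case]; first by case=> -[].
by move=> x y; rewrite (negPf (G0 x y)).
Qed.

Section BigUnion.

Variables (T : finType) (J : eqType) (G : J -> sgraph T).

Definition bigunion_rel (js : seq J) : rel T :=
  [rel x y | has (fun j => G j x y) js].

Lemma bigunion_sym js : symmetric (bigunion_rel js).
Proof. by move=> x y; apply: eq_has => j; exact: adj_sym. Qed.

Lemma bigunion_irrefl js : irreflexive (bigunion_rel js).
Proof. by move=> x; apply/hasP => -[j _]; rewrite adj_irrefl. Qed.

Definition bigunion js := SGraph (bigunion_sym js) (bigunion_irrefl js).

(** Induction on [js], splitting off the first graph by the binary union; [uniq js] and the
    condition on common edges make it edge-disjoint from the rest. *)
Lemma cycle_decomposable_bigunion (m n : nat) (r s : J -> nat) (js : seq J) :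
    uniq js ->
    {in js &, forall i j x y, G i x y -> G j x y -> i = j} ->
    {in js, forall j, cycle_decomposable (G j) m n (r j) (s j)} ->
  cycle_decomposable (bigunion js) m n (\sum_(j <- js) r j) (\sum_(j <- js) s j).
Proof.
elim: js => [|j js IH] /=; first by move=> *; rewrite !big_nil;
  apply: cycle_decomposable_empty.
move=> /andP[jNjs Ujs] disj dec; rewrite !big_cons.
apply: (cycle_decomposable_union (G1 := G j) (G2 := bigunion js)) => //.
- move=> x y Gj; apply/hasPn => i ijs; apply/negP => Gi.
  move: jNjs; rewrite (disj j i _ _ x y) ?ijs ?mem_head //.
  by rewrite inE ijs orbT.
- by apply: dec; rewrite mem_head.
- apply: IH => // [i k ijs kjs|i ijs]; last by apply: dec; rewrite inE ijs orbT.
  by apply: disj; rewrite inE ?ijs ?kjs orbT.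
Qed.

End BigUnion.

(** * Vertex degrees in decompositions *)

(** Double counting: each neighbour of [x] in [G] is its neighbour in exactly one [H i]. *)
Lemma degree_decomposition (T I : finType) (G : sgraph T) (H : I -> sgraph T)
    (x : T) :
  decomposition G H -> #|[set y | G x y]| = \sum_i #|[set y | H i x y]|.
Proof.
move=> [subH exH].
under eq_bigr do rewrite -sum1dep_card big_mkcond /=.
rewrite exchange_big -sum1dep_card big_mkcond /=; apply: eq_bigr => y _.
case: ifPn => [/exH [i [Hi Ui]]|nG].
  rewrite (bigD1 i) //= Hi big1 // => j ji.
  by case: ifP => // /Ui eij; rewrite eij eqxx in ji.
by rewrite big1 // => i _; case: ifP => // /subH; rewrite (negPf nG).
Qed.

Lemma degree_cycle_factor (T : finType) (m : nat) (G H : sgraph T) (x : T) :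
  2 < m -> cycle_factor m G H -> #|[set y | H x y]| = 2.
Proof.
move=> m_gt2 [_ /(_ x) [c [Uc sc Cc Hc]]].
have xC : x \in component H x by rewrite inE.
have xc : x \in c by move: xC; rewrite Cc inE.
have -> : [set y | H x y] = [set next c x; prev c x].
  apply/setP => y; rewrite !inE.
  have -> : (y == prev c x) = (x == next c y).
    by apply/eqP/eqP => ->; rewrite ?next_prev ?prev_next.
  (* [is_cycle] describes adjacency only inside the component; no edge leaves it, and [next] and
     [prev] stay in it. *)
  case: (boolP (y \in component H x)) => [yC|yNC]; first exact: Hc.
  apply/idP/idP => [Hxy|]; first by rewrite inE connect1 in yNC.
  rewrite Cc inE in yNC.
  by case/orP => /eqP E; case/negP: yNC; [rewrite E mem_next | rewrite -(mem_next c) -E].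
(* If the two neighbours coincided, two steps along the cycle would return to [x]. Rotating [c] to
   start at [x] contradicts this, since its first three entries are distinct. *)
rewrite cards2; case: eqP => // E; exfalso.
have: next c (next c x) = x by rewrite E next_prev.
have [k s Es] := rot_to xc.
rewrite -!(next_rot k Uc) Es.
move: Uc sc; rewrite -(rot_uniq k) -(size_rot k) Es.
case: s {Es} => [|y [|z s]] /=; [lia|lia|].
rewrite !inE !eqxx !negb_or => /andP[/and3P[xy xz _] _] _.
by rewrite eq_sym (negPf xy) => zx; rewrite zx eqxx in xz.
Qed.

(** * Disjoint copies of a graph *)

(* [inv x] is the inverse of the bijection that [q] induces from the
   [c]-class of [x] onto [S]. *)
Record fibrewise_bij (S T : finType) (K : eqType) (c : T -> K) (q : T -> S)
    (inv : T -> S -> T) : Prop := FibrewiseBij {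
  fib_class : forall x s, c (inv x s) = c x;
  fib_invK : forall x s, q (inv x s) = s;
  fib_K : forall x y, c y = c x -> inv x (q y) = y
}.

Lemma fib_eq (S T : finType) (K : eqType) (c : T -> K) (q : T -> S) inv x y :
  fibrewise_bij c q inv -> c x = c y -> (q x == q y) = (x == y).
Proof.
move=> cqP cxy; apply/eqP/eqP => [qxy|->//].
by rewrite -[x](fib_K cqP (y := x) erefl) qxy (fib_K cqP).
Qed.

Section Copies.

Variables (S T : finType) (K : eqType) (c : T -> K) (q : T -> S).

(** When [q] is bijective from each class onto [S], this is one copy of [H] per class. Nothing of
    the kind is built in: with [fst] or [id] for [q], it also restricts a graph to pairs within one
    class. *)
Definition copies_rel (H : rel S) : rel T := [rel x y | (c x == c y) && H (q x) (q y)].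

Lemma copies_sym (H : sgraph S) : symmetric (copies_rel H).
Proof. by move=> x y; rewrite /copies_rel /= eq_sym (adj_sym H). Qed.

Lemma copies_irrefl (H : sgraph S) : irreflexive (copies_rel H).
Proof. by move=> x; rewrite /copies_rel /= adj_irrefl andbF. Qed.

Definition copies (H : sgraph S) : sgraph T :=
  SGraph (@copies_sym H) (@copies_irrefl H).

Lemma copiesE (H : sgraph S) x y :
  copies H x y = (c x == c y) && H (q x) (q y).
Proof. by []. Qed.

Variable (inv : T -> S -> T).
Hypothesis cqP : fibrewise_bij c q inv.

Lemma fib_inv_inj x : injective (inv x).
Proof. exact: can_inj (fib_invK cqP x). Qed.

(** A path of the copies stays in one class and projects by [q]; conversely a path of [H] lifts
    vertex by vertex through [inv]. *)
Lemma connect_copies (H : sgraph S) x y :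
  connect (copies H) x y = (c x == c y) && connect H (q x) (q y).
Proof.
apply/idP/andP => [/connectP [p]|[/eqP cxy /connectP [p]]].
  elim: p x => [|z p IH] x /=; first by move=> _ ->; rewrite eqxx connect0.
  move=> /andP[/andP[/eqP -> Hxz] pz] Ey; have [-> Hzy] := IH z pz Ey.
  by split=> //; apply: connect_trans Hzy; exact: connect1.
elim: p x cxy => [|s p IH] x cxy /=.
  by move=> _ qyx; rewrite -(fib_K cqP (esym cxy)) qyx (fib_K cqP).
move=> /andP[Hxs ps] qy.
have : connect (copies H) (inv x s) y.
  by apply: IH; rewrite ?(fib_class cqP) ?(fib_invK cqP).
apply: connect_trans; apply: connect1.
by rewrite copiesE (fib_class cqP) (fib_invK cqP) eqxx.
Qed.

(** The component of [x] is the image under [inv x] of the component of [q x], so the cycle lifts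
    entry by entry. *)
Lemma cycle_factor_copies (m : nat) (G H : sgraph S) :
  cycle_factor m G H -> cycle_factor m (copies G) (copies H).
Proof.
move=> [HG Hcyc]; split=> [x y /andP[cxy /HG Gxy]|x]; first exact/andP.
have [l [Ul sl Cl Hl]] := Hcyc (q x).
have Cx : component (copies H) x = [set:: map (inv x) l].
  apply/setP => y; rewrite !inE connect_copies.
  have -> : connect H (q x) (q y) = (q y \in l).
    by move/setP/(_ (q y)): Cl; rewrite !inE.
  apply/andP/mapP => [[/eqP cxy ly]|[s ls ->]].
    by exists (q y) => //; rewrite (fib_K cqP).
  by rewrite (fib_class cqP) (fib_invK cqP) eqxx.
exists (map (inv x) l); split=> //.
- by rewrite map_inj_uniq //; exact: fib_inv_inj.
- by rewrite size_map.
move=> y z; rewrite Cx !inE => /mapP[s ls ->] /mapP[t lt ->].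
have lC w : w \in l -> w \in component H (q x) by rewrite Cl inE.
rewrite copiesE !(fib_class cqP) !(fib_invK cqP) eqxx Hl ?lC //=.
by rewrite !next_map ?(inj_eq (@fib_inv_inj x)) //; exact: fib_inv_inj.
Qed.

Lemma cycle_decomposable_copies (G : sgraph S) (m n r s : nat) :
  cycle_decomposable G m n r s -> cycle_decomposable (copies G) m n r s.
Proof.
move=> [H [[subH exH] Hm Hn]]; exists (fun i => copies (H i)); split.
- split=> [i x y /andP[cxy /subH Gxy]|x y /andP[cxy /exH [i [Hi Ui]]]].
    exact/andP.
  exists i; split; first exact/andP.
  by move=> j /andP[_ /Ui].
- by move=> i; exact: cycle_factor_copies.
- by move=> i; exact: cycle_factor_copies.
Qed.

Lemma one_factor_copies (F : sgraph S) :
  one_factor (complete S) F -> one_factor (complete T) (copies F).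
Proof.
move=> [_ F1]; split=> [x y Fxy|x].
  by apply/eqP => exy; rewrite exy adj_irrefl in Fxy.
rewrite -(F1 (q x)) -(card_imset _ (@fib_inv_inj x)); apply: eq_card => y.
rewrite inE; apply/andP/imsetP => [[/eqP cxy Fxy]|[s]].
  by exists (q y); rewrite ?inE // (fib_K cqP).
by rewrite inE => Fs ->; rewrite (fib_class cqP) (fib_invK cqP) eqxx.
Qed.

End Copies.

(** * Hamilton-Waterloo decompositions on arbitrary vertex types *)

Lemma bij_fibrewise (S T : finType) (q : T -> S) (g : S -> T) :
  cancel q g -> cancel g q -> fibrewise_bij (fun=> tt) q (fun=> g).
Proof. by move=> qK gK; split. Qed.

Lemma completeE (T : finType) (x y : T) : complete T x y = (x != y).
Proof. by []. Qed.

Lemma gminusE (T : finType) (G F : sgraph T) x y :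
  gminus G F x y = G x y && ~~ F x y.
Proof. by []. Qed.

(** [HWP] lives on an ordinal, whereas the construction produces graphs on [V * 'I_x]; this form
    avoids renumbering vertices there. *)
Definition HWP_on (T : finType) (m n r s : nat) : Prop :=
  if odd #|T| then cycle_decomposable (complete T) m n r s
  else exists F : sgraph T,
    one_factor (complete T) F /\
    cycle_decomposable (gminus (complete T) F) m n r s.

(** A bijection is the case of a single class, so the results on copies transport everything. *)
Lemma HWP_on_bij (S T : finType) (q : T -> S) (g : S -> T) (m n r s : nat) :
  cancel q g -> cancel g q -> HWP_on S m n r s -> HWP_on T m n r s.
Proof.
move=> qK gK; have cqP := bij_fibrewise qK gK.
have qE x y : (q x == q y) = (x == y) by rewrite (can_eq qK).
rewrite /HWP_on (bij_eq_card (Bijective qK gK)); case: ifP => _.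
  move/(cycle_decomposable_copies cqP); apply: eq_cycle_decomposable => x y.
  by rewrite copiesE completeE qE.
move=> [F [F1 D]]; exists (copies (fun=> tt) q F).
split; first exact: one_factor_copies cqP _ F1.
move: D => /(cycle_decomposable_copies cqP); apply: eq_cycle_decomposable => x y.
by rewrite gminusE !copiesE gminusE !completeE qE.
Qed.

Lemma HWP_onE (T : finType) (m n r s : nat) :
  HWP_on T m n r s <-> HWP m n #|T| r s.
Proof.
have -> : HWP m n #|T| r s = HWP_on 'I_#|T| m n r s by rewrite /HWP_on card_ord.
split; first exact: HWP_on_bij enum_valK enum_rankK.
by apply: HWP_on_bij enum_rankK enum_valK.
Qed.

(** Every factor contributes 2 to the degree of [x]. *)
Lemma cycle_decomposable_even_degree (T : finType) (G : sgraph T)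
    (m n r s : nat) (x : T) :
  2 < m -> 2 < n -> cycle_decomposable G m n r s -> ~~ odd #|[set y | G x y]|.
Proof.
move=> m2 n2 [H [D Hm Hn]]; rewrite (degree_decomposition x D).
rewrite (eq_bigr (fun=> 2)) ?sum_nat_const ?muln2 ?odd_double // => -[] i _.
  exact: degree_cycle_factor (Hm i).
exact: degree_cycle_factor (Hn i).
Qed.

(** * Coordinates on blocks of equal size *)

(** The coordinate of a point is its position in the enumeration of its block. The enumeration
    depends on the block alone, so this is bijective from each block onto ['I_k]. *)
Lemma partition_fibrewise (V : finType) (Q : {set {set V}}) (k : nat) :
    partition Q [set: V] -> (forall b, b \in Q -> #|b| = k) ->
  exists (q : V -> 'I_k) inv, fibrewise_bij (pblock Q) q inv.
Proof.
move=> /and3P[/eqP cQ tQ _] Qk.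
have in_cover a : a \in cover Q by rewrite cQ.
have bk a : #|pblock Q a| = k by apply: Qk; rewrite pblock_mem.
have ltk a : index a (enum (pblock Q a)) < k.
  by rewrite -(bk a) cardE index_mem mem_enum mem_pblock.
exists (fun a => Ordinal (ltk a)), (fun a (i : 'I_k) => nth a (enum (pblock Q a)) i).
have mem_nth_block a (i : 'I_k) : nth a (enum (pblock Q a)) i \in pblock Q a.
  by rewrite -mem_enum mem_nth // -cardE bk.
have same a (i : 'I_k) : pblock Q (nth a (enum (pblock Q a)) i) = pblock Q a.
  exact/same_pblock.
split=> // [a i|a b ab]; first apply: val_inj => /=.
  by rewrite same index_uniq ?enum_uniq // -cardE bk.
by rewrite /= ab nth_index // mem_enum -ab mem_pblock.
Qed.

Lemma fibrewise_prod (S V I : finType) (K : eqType) (c : V -> K) (q : V -> S)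
    inv :
  fibrewise_bij c q inv ->
  fibrewise_bij (fun w : V * I => c w.1) (fun w => (q w.1, w.2))
    (fun w s => (inv w.1 s.1, s.2)).
Proof.
move=> cqP; split=> [w s|w [s i]|w [b i]] /=; first exact: fib_class cqP _ _.
  by rewrite (fib_invK cqP).
by move=> bw; rewrite (fib_K cqP).
Qed.

(* The graph is the disjoint union, over the blocks of [Q], of the complete
   multipartite graphs whose parts are the sets {a} * 'I_x, a in the block. *)
Lemma cycle_decomposable_blocks (V : finType) (Q : {set {set V}}) (x k : nat)
    (m n r s : nat) :
    partition Q [set: V] -> (forall b, b \in Q -> #|b| = k) ->
    cycle_decomposable (multipartite x k) m n r s ->
  cycle_decomposable
    (copies (fun w : V * 'I_x => pblock Q w.1) fst (complete V)) m n r s.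
Proof.
move=> partQ Qk; have [q [inv cqP]] := partition_fibrewise partQ Qk.
move/(cycle_decomposable_copies (fibrewise_prod 'I_x cqP)).
apply: eq_cycle_decomposable => w w'; rewrite !copiesE completeE.
by case: eqP => //= cww'; rewrite -(fib_eq cqP cww').
Qed.

Lemma degree_blocks (V : finType) (Q : {set {set V}}) (k : nat) (a : V) :
    partition Q [set: V] -> (forall b, b \in Q -> #|b| = k) ->
  #|[set b | copies (pblock Q) id (complete V) a b]| = k.-1.
Proof.
move=> /and3P[/eqP cQ tQ _] Qk.
have in_cover b : b \in cover Q by rewrite cQ.
rewrite -(Qk (pblock Q a)) ?pblock_mem // [in RHS](cardsD1 a) mem_pblock in_cover.
apply: eq_card => b; rewrite !inE copiesE completeE andbC eq_sym.
by rewrite eq_pblock.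
Qed.

(** * Parallel classes of the design *)

Section Resolution.

Variables (h u : nat) (V : finType) (Gr B : {set {set V}}).
Hypothesis rgdd : is_RGDD3 h u Gr B.
Hypothesis h_gt0 : 0 < h.

Let nclasses := (h * (u - 1)) %/ 2.

(** The incidence axioms become equalities of [pblock] values, the form in which [copies] uses
    classes. The number of parallel classes comes from counting degrees. *)
Lemma rgdd_classes :
  exists Q : nat -> {set {set V}},
  [/\ 0 < nclasses,
      forall p, p < nclasses ->
        partition (Q p) [set: V] /\ (forall b, b \in Q p -> #|b| = 3),
      forall p a b, p < nclasses -> pblock Gr a = pblock Gr b ->
        pblock (Q p) a = pblock (Q p) b -> a = b,
      forall a b, pblock Gr a <> pblock Gr b ->
        exists2 p, p < nclasses & pblock (Q p) a = pblock (Q p) b &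
      forall p p' a b, p < nclasses -> p' < nclasses -> a <> b ->
        pblock (Q p) a = pblock (Q p) b -> pblock (Q p') a = pblock (Q p') b ->
        p = p'].
Proof.
have [cardV partGr u_gt1 _ Grh B3 same diff [P [partP resP]]] := rgdd.
have /and3P[/eqP cP tP _] := partP.
have /and3P[/eqP cGr tGr _] := partGr.
pose Q p := nth set0 (enum P) p.
have QP p : p < #|P| -> Q p \in P by move=> pP; rewrite -mem_enum mem_nth // -cardE.
have partQ p : p < #|P| -> partition (Q p) [set: V] by move=> /QP /resP.
have Qin p a : p < #|P| -> a \in pblock (Q p) a /\ pblock (Q p) a \in Q p.
  by move=> /partQ /and3P[/eqP cQ _ _]; rewrite mem_pblock pblock_mem ?cQ.
have QB p b : p < #|P| -> b \in Q p -> b \in B.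
  by move=> pP bQ; rewrite -cP; apply/bigcupP; exists (Q p); rewrite ?QP.
have grin a : a \in pblock Gr a /\ pblock Gr a \in Gr.
  by rewrite mem_pblock pblock_mem ?cGr.
have Qab p a b : p < #|P| -> pblock (Q p) a = pblock (Q p) b ->
    [/\ pblock (Q p) a \in B, a \in pblock (Q p) a & b \in pblock (Q p) a].
  move=> pP Qab; have [aQ QQ] := Qin p a pP; have [bQ _] := Qin p b pP.
  by split; rewrite // ?(QB p) // Qab.
have F1 p a b : p < #|P| -> pblock Gr a = pblock Gr b ->
    pblock (Q p) a = pblock (Q p) b -> a = b.
  move=> pP Gab /(Qab p a b pP) [bB ab bb]; apply/eqP/negPn/negP => nab.
  have [aG GG] := grin a; have [bG _] := grin b; rewrite -Gab in bG.
  by have := same _ _ _ _ GG aG bG nab bB; rewrite ab bb.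
have F2 a b : pblock Gr a <> pblock Gr b ->
    exists2 p, p < #|P| & pblock (Q p) a = pblock (Q p) b.
  move=> /eqP Gab; have [aG aGG] := grin a; have [bG bGG] := grin b.
  have /eqP/cards1P[d Ed] := diff _ _ _ _ aGG bGG Gab aG bG.
  have: d \in [set d] by rewrite inE.
  rewrite -Ed inE => /and3P[]; rewrite -cP => /bigcupP[C CP dC] ad bd.
  have pP : index C (enum P) < #|P| by rewrite cardE index_mem mem_enum.
  have EQ : Q (index C (enum P)) = C by rewrite /Q nth_index ?mem_enum.
  exists (index C (enum P)) => //.
  have /and3P[_ tQ _] := partQ _ pP.
  by rewrite EQ in tQ *; rewrite !(def_pblock tQ dC).
have F3 p p' a b : p < #|P| -> p' < #|P| -> a <> b ->
    pblock (Q p) a = pblock (Q p) b -> pblock (Q p') a = pblock (Q p') b ->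
    p = p'.
  move=> pP pP' nab E E'.
  have [bB ab bb] := Qab _ _ _ pP E; have [bB' ab' bb'] := Qab _ _ _ pP' E'.
  have Gab : pblock Gr a != pblock Gr b.
    by apply/eqP => Gab; apply: nab; apply: F1 E.
  have [aG aGG] := grin a; have [bG bGG] := grin b.
  have /eqP/cards1P[d Ed] := diff _ _ _ _ aGG bGG Gab aG bG.
  (* Both blocks equal the unique block [d] through [a] and [b]; since [P] partitions [B], that
     block lies in only one class. *)
  have Eb : pblock (Q p) a = pblock (Q p') a.
    transitivity d; first by apply/set1P; rewrite -Ed inE bB ab.
    by apply/esym/set1P; rewrite -Ed inE bB' ab'.
  have EQ : Q p = Q p'.
    have [_ iQ] := Qin p a pP; have [_ iQ'] := Qin p' a pP'.
    rewrite -Eb in iQ'.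
    by rewrite -(def_pblock tP (QP p pP) iQ) -(def_pblock tP (QP p' pP') iQ').
  apply/eqP; move/eqP: EQ; rewrite nth_uniq ?enum_uniq // -cardE //.
(* A point [a] has [h * (u - 1)] points outside its group, and each parallel class joins it to 2 of
   them. *)
have card2P : h * (u - 1) = #|P| * 2.
  have /card_gt0P[a _] : 0 < #|V| by rewrite cardV muln_gt0 h_gt0; lia.
  pose Gdiff := gminus (complete V) (copies (pblock Gr) id (complete V)).
  have D : decomposition Gdiff
      (fun p : 'I_#|P| => copies (pblock (Q p)) id (complete V)).
    split=> [p b c|b c].
      rewrite copiesE gminusE copiesE => /andP[/eqP Qbc bc].
      rewrite bc andbT; apply/eqP => Gbc.
      by move: bc; rewrite (F1 p b c) ?adj_irrefl.
    rewrite gminusE copiesE => /andP[bc]; rewrite bc andbT => /eqP Gbc.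
    have [p pP Qbc] := F2 b c Gbc.
    exists (Ordinal pP); split; first by rewrite copiesE bc Qbc eqxx.
    move=> p' /andP[/eqP Qbc' _]; apply: val_inj => /=.
    by apply: (F3 p p' b c) => //; apply/eqP.
  have := degree_decomposition a D.
  rewrite (eq_bigr (fun=> 2)) => [|p _]; last first.
    by apply: (degree_blocks (k := 3)); [exact: partQ | move=> b /QB /B3; exact].
  rewrite sum_nat_const card_ord => <-.
  rewrite mulnBr muln1 -cardV -(cardsC (pblock Gr a)) (Grh _ (proj2 (grin a))) addKn.
  apply: eq_card => b; rewrite !inE gminusE copiesE completeE.
  rewrite eq_pblock ?cGr //; case: (eqVneq a b) => [<-|ab] /=; last by rewrite andbT.
  by rewrite mem_pblock cGr inE.
have -> : nclasses = #|P| by rewrite /nclasses card2P mulnK.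
exists Q; split=> //.
  by rewrite -(ltn_pmul2r (isT : 0 < 2)) -card2P muln_gt0 h_gt0 subn_gt0.
by move=> p pP; split; [exact: partQ | move=> b /(QB p b pP) /B3].
Qed.

End Resolution.

(** * Gluing the pieces over the inflated design *)

Theorem lemma15 (m n x h u : nat) (r_beta s_beta r_gamma s_gamma : nat)
    (r s : nat -> nat)
    (hm : 3 <= m) (hn : 3 <= n) (hx : 0 < x)
    (hmx : m %| 3 * x) (hnx : n %| 3 * x) (hh : 0 < h) (hu : 0 < u)
    (Hrgdd : RGDD3 h u)
    (Hbeta : HWP m n (3 * x) r_beta s_beta)
    (Hgamma : cycle_decomposable (multipartite x h) m n r_gamma s_gamma)
    (Hp : forall p : nat, 1 <= p <= (h * (u - 1)) %/ 2 ->
       cycle_decomposable (multipartite x 3) m n (r p) (s p)) :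
  let r_alpha := \sum_(1 <= p < (h * (u - 1)) %/ 2) r p in
  let s_alpha := \sum_(1 <= p < (h * (u - 1)) %/ 2) s p in
  HWP m n (h * u * x) (r_alpha + r_beta + r_gamma)
    (s_alpha + s_beta + s_gamma).
Proof.
set t := _ %/ 2 in Hp *; move=> r_alpha s_alpha.
have [V [Gr [B rgdd]]] := Hrgdd.
have [Q [t_gt0 partQ sameQ diffQ uniqQ]] := rgdd_classes rgdd hh.
rewrite -/t in t_gt0 partQ sameQ diffQ uniqQ.
(* Class 0 is reserved for the copies of the HWP; classes 1 to [t - 1] remain, exactly the range of
   the sums [r_alpha] and [s_alpha]. *)
have [q0 [inv0 cqP0]] := partition_fibrewise (partQ 0 t_gt0).1 (partQ 0 t_gt0).2.
have cqP := fibrewise_prod 'I_x cqP0.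
set c := fun w : V * 'I_x => _ in cqP.
set q := fun w : V * 'I_x => (q0 w.1, w.2) in cqP.
(* Both parities at once: [G] is copied from [Gb] on each inflated block of class 0 and is complete
   elsewhere. *)
have core (Gb : sgraph ('I_3 * 'I_x)%type) (G : sgraph (V * 'I_x)%type) :
    cycle_decomposable Gb m n r_beta s_beta ->
    (forall w w', G w w' =
       if c w == c w' then Gb (q w) (q w') else w != w') ->
  cycle_decomposable G m n (r_alpha + r_beta + r_gamma) (s_alpha + s_beta + s_gamma).
  move=> DGb GE.
  pose alpha p := copies (fun w : V * 'I_x => pblock (Q p) w.1) fst (complete V).
  pose beta := copies c q Gb.
  pose gamma := copies (fun w : V * 'I_x => pblock Gr w.1) fst (complete V).
  pose js := index_iota 1 t.
  have alpha_lt p : p \in js -> 0 < p < t by rewrite mem_index_iota.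
  have alphaP p w w' : alpha p w w' ->
      pblock (Q p) w.1 = pblock (Q p) w'.1 /\ w.1 <> w'.1.
    by rewrite copiesE completeE => /andP[/eqP ? /eqP].
  have gammaP w w' : gamma w w' -> pblock Gr w.1 = pblock Gr w'.1 /\ w.1 <> w'.1.
    by rewrite copiesE completeE => /andP[/eqP ? /eqP].
  have neq_fst (w w' : V * 'I_x) : w.1 <> w'.1 -> w != w'.
    by move=> neq; apply/eqP => ww'; apply: neq; rewrite ww'.
  have gammaG w w' : gamma w w' -> G w w'.
    move=> /gammaP[Gww' neq]; rewrite GE; case: eqP => [E|_]; last exact: neq_fst.
    by case: neq; exact: sameQ E.
  have alphaNbeta w w' : bigunion alpha js w w' -> ~~ beta w w'.
    move=> /hasP[p /alpha_lt/andP[p0 pt] /alphaP[E neq]].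
    apply/negP => /andP[/eqP E0 _].
    by rewrite (uniqQ p 0 w.1 w'.1) in p0.
  apply: (cycle_decomposable_union (G1 := gminus G gamma) (G2 := gamma)).
  - move=> w w'; rewrite gminusE.
    by case: (boolP (gamma w w')) => [/gammaG ->|]; rewrite ?andbT ?orbF.
  - by move=> w w' /andP[].
  - apply: (cycle_decomposable_union (G1 := bigunion alpha js) (G2 := beta)).
    + move=> w w'; apply/idP/orP => [|[]].
      * rewrite gminusE GE (copiesE _ _ Gb) => /andP[]; case: eqP => [_ ->|nE ww' nG].
          by right.
        (* An edge outside [gamma] and outside the inflated blocks of class 0: its ends lie over
           distinct points, since a fibre stays inside one block, and over different groups, so some
           class [p] joins these points, and [p] is not 0. *)
        left; have [Eww'|/eqP neq] := eqVneq w.1 w'.1.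
          by case: nE; rewrite /c Eww'.
        have [|p pt E] := diffQ w.1 w'.1.
          move=> Gww'; case/negP: nG; rewrite copiesE completeE Gww' eqxx.
          exact/eqP.
        apply/hasP; exists p; last by rewrite copiesE completeE E eqxx; apply/eqP.
        rewrite mem_index_iota pt andbT lt0n; apply/eqP => p0.
        by case: nE; rewrite /c -p0.
      * move=> /[dup] /alphaNbeta nb /hasP[p /alpha_lt/andP[p0 pt] /alphaP[E neq]].
        rewrite gminusE GE; apply/andP; split; last first.
          by apply/negP => /gammaP[Gww' _]; apply: neq; exact: sameQ E.
        (* Two points joined in class [p > 0] are not joined in class 0, so [G] is complete at this
           pair. *)
        case: eqP => [E0|_]; last exact: neq_fst.
        by rewrite (uniqQ p 0 w.1 w'.1) in p0.
      * rewrite copiesE => /andP[/eqP E0 Gww']; rewrite gminusE GE E0 eqxx Gww' /=.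
        by apply/negP => /gammaP[Gr_ww']; case; exact: sameQ E0.
    + exact: alphaNbeta.
    + apply: cycle_decomposable_bigunion; first exact: iota_uniq.
        move=> i j /alpha_lt/andP[_ it] /alpha_lt/andP[_ jt] w w'.
        move=> /alphaP[Ei neq] /alphaP[Ej _].
        exact: uniqQ neq Ei Ej.
      move=> p /alpha_lt/andP[p0 pt]; have [partQp Qp3] := partQ p pt.
      apply: cycle_decomposable_blocks partQp Qp3 _.
      by apply: Hp; rewrite p0 ltnW.
    + exact: cycle_decomposable_copies cqP _ _ _ _ _ DGb.
  - apply: cycle_decomposable_blocks (rgdd_groups rgdd) _ Hgamma.
    exact: rgdd_group_size rgdd.
have cardW : #|{: V * 'I_x}| = h * u * x.
  by rewrite card_prod card_ord (rgdd_points rgdd).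
rewrite -cardW; apply/HWP_onE.
have : HWP_on ('I_3 * 'I_x)%type m n r_beta s_beta.
  by apply/HWP_onE; rewrite card_prod !card_ord.
have q_eq w w' : c w = c w' -> (q w == q w') = (w == w').
  exact: fib_eq cqP.
rewrite /HWP_on card_prod !card_ord cardW; case: ifP => x_odd.
  move=> Dbeta; have D : cycle_decomposable (complete (V * 'I_x)%type) m n
      (r_alpha + r_beta + r_gamma) (s_alpha + s_beta + s_gamma).
    apply: core Dbeta _ => w w'; rewrite !completeE.
    by case: (c w =P c w') => [E|//]; rewrite q_eq.
  (* [x] odd does not force [h * u] odd by arithmetic alone; it follows from
     the even degrees in the decomposition just built. *)
  suff -> : odd (h * u * x) by [].
  have [w _] : exists w, w \in {: V * 'I_x}.
    by apply/card_gt0P; rewrite cardW !muln_gt0 hh hu.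
  have := cycle_decomposable_even_degree w hm hn D.
  have -> : [set y | complete _ w y] = [set~ w].
    by apply/setP => y; rewrite !inE completeE eq_sym.
  rewrite cardsC1 cardW.
  have : 0 < h * u * x by rewrite !muln_gt0 hh hu.
  by case: (h * u * x) => //= k _; rewrite negbK.
move=> [F [F1 D]].
(* As [3 * x] is even, so is [x]. *)
have -> : odd (h * u * x) = false.
  by move: x_odd; rewrite !oddM /= => ->; rewrite andbF.
(* The removed 1-factor is the union of the copies of [F] on the inflated blocks of class 0. *)
exists (copies c q F); split; first exact: one_factor_copies cqP _ F1.
apply: core D _ => w w'; rewrite !gminusE copiesE !completeE.
case: (c w =P c w') => [E|_]; last by rewrite andbT.
by rewrite q_eq.
Qed.
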